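(* $n(10,7) \leq 1608$; that is, there exists a $10$-regular graph of girth exactly $7$ with at most $1608$ vertices.
   Context: Graphs are finite and simple. For integers $k\ge 2$, $g\ge 3$, a $(k,g)$-graph is a $k$-regular graph with girth $g$ (the length of a shortest cycle is exactly $g$). $n(k,g)$ denotes the smallest possible number of vertices of a $(k,g)$-graph. *)

(* Defs.v *)
From mathcomp Require Import all_boot.

Set Implicit Arguments.
Unset Strict Implicit.
Unset Printing Implicit Defensive.

(* Finite simple graphs. *)
Record sgraph := SGraph {
  vertex :> finType;
  adj : rel vertex;
  adj_sym : symmetric adj;
  adj_irrefl : irreflexive adj
}.

Definition regular (G : sgraph) (k : nat) : Prop :=
  forall x : G, #|[set y | adj x y]| = k.

(* [ucycle] also accepts sequences of size 0 and 2 (an edge traversed back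
   and forth), which are not cycles of a simple graph; hence the bound 3. *)
Definition graph_cycle (G : sgraph) (c : seq G) : Prop :=
  3 <= size c /\ ucycle (@adj G) c.

(* [has_girth G g] fails for every g when G is acyclic. *)
Definition has_girth (G : sgraph) (g : nat) : Prop :=
  (exists2 c : seq G, graph_cycle c & size c = g) /\
  (forall c : seq G, graph_cycle c -> g <= size c).

Definition kg_graph (k g : nat) (G : sgraph) : Prop :=
  regular G k /\ has_girth G g.

(* [is_n k g N] says that n(k,g) exists and equals N.  It is a relation, so
   that no default value is needed where there is no (k,g)-graph. *)
Definition is_n (k g N : nat) : Prop :=
  (exists2 G : sgraph, kg_graph k g G & #|G| = N) /\
  (forall G : sgraph, kg_graph k g G -> N <= #|G|).

(* Main.v *)
Require Import Defs.
From mathcomp Require Import all_boot.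
From Stdlib Require Import Classical_Prop PArith FMapPositive.

(* Start from the incidence graph, of girth 8 on 1640 vertices, of the
   generalized quadrangle of order 9 built from the quadratic polynomials over
   GF(9).  One side consists of the circles f = k t^2 + m t + n, the points
   (x, y) with x on the projective line, and a vertex oo; the other side consists
   of the flags (x, y, d), joined to the point (x, y) and to the circles f with
   f(x) = y and f'(x) = d, and of the parallel classes x, joined to oo and to all
   points (x, y).

   Delete the circle 0, the vertex oo and the ten paths between them formed by
   the flag (x, 0, 0), the point (x, 0) and the class x: 32 vertices.  The
   remaining neighbours of each deleted inner vertex form a set of 8 vertices of
   degree 9, pairwise at distance at least 6, on which a perfect matching is
   added.  A cycle shorter than 7 would have to consist of two added edges from
   different sets and two paths of length 2 joining their ends.  For points and
   circles these paths act as y -> s y with s a square, for the flags (x, 0, d)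
   as d -> -d or d -> d, and the matchings are chosen so that no edge is sent to
   an edge in this way.  The absence of short cycles is then verified by
   evaluation. *)

Set Implicit Arguments.
Unset Strict Implicit.
Unset Printing Implicit Defensive.

(** It is applied to the existence of a (10,7)-graph of given order, which is not a boolean
    property, hence excluded middle. *)
Lemma ex_min_nat (P : nat -> Prop) n :
  P n -> exists2 m, P m & m <= n /\ forall k, P k -> m <= k.
Proof.
elim/ltn_ind: n => n IHn Pn.
have [[k Pk lt_kn]|min_n] := classic (exists2 k, P k & k < n).
  have [m Pm [le_mk min_m]] := IHn k lt_kn Pk.
  by exists m => //; split=> //; apply: leq_trans le_mk (ltnW lt_kn).
exists n => //; split=> // k Pk.
by rewrite leqNgt; apply/negP => lt_kn; apply: min_n; exists k.
Qed.

(** * Girth from paths with a common end *)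

Definition arm (G : sgraph) m (v : G) (p : seq G) :=
  [&& path (@adj G) v p, uniq (v :: p) & 0 < size p <= m].

Lemma arm_take (G : sgraph) m v s i :
  path (@adj G) v s -> uniq (v :: s) ->
  0 < i <= m -> i <= size s -> arm m v (take i s).
Proof.
move=> ps us im le_is; apply/and3P; split.
- exact: take_path.
- by rewrite (take_uniq i.+1 us).
- by rewrite size_takel.
Qed.

(* A cycle of length at most [2 * m] splits, from any of its vertices, into two
   arms with the same end. *)
Lemma girth_gt_of_arms (G : sgraph) m :
  (forall (v : G) p q, arm m v p -> arm m v q ->
     last v p = last v q -> p = q) ->
  forall c : seq G, graph_cycle c -> m.*2 < size c.
Proof.
move=> arm_inj c [c3 /andP[cyc uc]].
case: c c3 cyc uc => [//|v s] /= c3 cs us.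
rewrite ltnS in c3; rewrite ltnS leqNgt; apply/negP=> short.
have cs' : cycle (@adj G) (v :: rev s).
  have -> : v :: rev s = rev (rot 1 (v :: s)).
    by rewrite rot1_cons rev_rcons.
  rewrite rev_cycle rot_cycle (eq_cycle (e' := @adj G)) // => x y.
  exact: adj_sym.
have ps : path (@adj G) v s by move: cs; rewrite /= rcons_path => /andP[].
have ps' : path (@adj G) v (rev s).
  by move: cs'; rewrite /= rcons_path => /andP[].
have us' : uniq (v :: rev s) by rewrite /= mem_rev rev_uniq.
set n := size s in short c3.
have En : n = n./2 + uphalf n.
  by rewrite uphalf_half addnCA addnn odd_double_half.
have k0 : 0 < uphalf n by rewrite uphalf_gt0 ltnW.
have kn : uphalf n <= n by rewrite {2}En leq_addl.
have jn : n./2 < n by rewrite {2}En -{1}[n./2]addn0 ltn_add2l.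
have jm : n./2 < m by rewrite ltn_half_double.
have km : uphalf n <= m by rewrite leq_uphalf_double ltnW.
(* The cycle has n + 1 edges: [uphalf n] of them form one arm, the other n./2 + 1 the arm running
   backwards. *)
have := arm_inj v (take (uphalf n) s) (take n./2.+1 (rev s)).
rewrite !arm_take ?size_rev ?k0 //; move/(_ isT isT).
have last_take x (t : seq G) j : j < size t -> last x (take j.+1 t) = nth x t j.
  by move=> lt_j; rewrite (last_nth x) size_takel //= nth_take.
have [k Ek] : exists k, uphalf n = k.+1.
  by case: (uphalf n) k0 => // k; exists k.
rewrite Ek !last_take ?size_rev -?Ek // nth_rev // -/n.
have -> : n - n./2.+1 = k by rewrite {1}En Ek addnS subSS addKn.
move=> /(_ erefl) eq_pq.
(* Equal arms have the same first vertex, but the first and last entries of [s] differ since n >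
   1. *)
have := congr1 (nth v ^~ 0) eq_pq.
rewrite Ek !nth_take // nth_rev ?(ltnW c3) // -/n => /eqP.
case/andP: us => _ us; rewrite nth_uniq ?(ltnW c3) //; last first.
  by rewrite ltn_subrL (ltnW c3).
by rewrite subn1; case: (n) c3 => [|[]].
Qed.

(* GF(3), with elements 0, 1, -1. *)
Notation trit := (option bool).
Notation T0 := None.
Notation T1 := (Some true).
Notation Tm := (Some false).

Definition trit_opp (s : trit) : trit := omap negb s.
Definition trit_add (s t : trit) : trit :=
  match s, t with
  | None, _ => t
  | _, None => s
  | Some b, Some c => if b (+) c then None else Some (~~ b)
  end.
Definition trit_mul (s t : trit) : trit :=
  match s, t with Some b, Some c => Some (~~ (b (+) c)) | _, _ => None end.

(* The pair (a, b) is a + b i in GF(9) = GF(3)[i], i^2 = -1. *)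
Notation F9 := (trit * trit)%type.

Definition zero : F9 := (T0, T0).
Definition add (x y : F9) : F9 := (trit_add x.1 y.1, trit_add x.2 y.2).
Definition opp (x : F9) : F9 := (trit_opp x.1, trit_opp x.2).
Definition mul (x y : F9) : F9 :=
  (trit_add (trit_mul x.1 y.1) (trit_opp (trit_mul x.2 y.2)),
   trit_add (trit_mul x.1 y.2) (trit_mul x.2 y.1)).
Definition is_zero (x : F9) := if x is (T0, T0) then true else false.

(* [None] is the point at infinity of the projective line; there a polynomial
   takes its leading coefficient as value and the next one as slope. *)
Notation pline := (option F9).

Notation vert := ((F9 * F9 * F9) + (pline * F9 + pline * F9 * F9))%type.
Notation circle k m n := (inl (k, m, n)).
Notation point x y := (inr (inl (x, y))).
Notation flag x y d := (inr (inr (x, y, d))).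

Definition eval (x : pline) (k m n : F9) : F9 :=
  if x is Some t then add (mul (add (mul k t) m) t) n else k.
(* The derivative, since 2 = -1. *)
Definition slope (x : pline) (k m n : F9) : F9 :=
  if x is Some t then add (opp (mul k t)) m else m.
(* The circle through [flag x y d] with free coefficient [c]. *)
Definition touching (x : pline) (y d c : F9) : vert :=
  if x is Some t then
    circle c (add d (mul c t)) (add (mul (add (mul c t) (opp d)) t) y)
  else circle y d c.

(* The circles c (t - x)^2 with c a square are matched with their multiples by
   the generator g = 1 + i of the multiplicative group, so that the ratio is never
   -1 as it is for points.  Squares have a zero coordinate, and g^-1 = i - 1. *)
Definition ratio (c : F9) : F9 :=
  match c with (T0, _) | (_, T0) => (T1, T1) | _ => (Tm, T1) end.

(* A perfect matching disjoint from its opposite and from [d <-> - d]. *)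
Definition mate (d : F9) : F9 :=
  match d with
  | (T0, T0) => (T0, T0)
  | (T1, T0) => (T1, T1) | (T1, T1) => (T1, T0)
  | (Tm, T0) => (T0, T1) | (T0, T1) => (Tm, T0)
  | (T0, Tm) => (T1, Tm) | (T1, Tm) => (T0, Tm)
  | (Tm, T1) => (Tm, Tm) | (Tm, Tm) => (Tm, T1)
  end.

Definition trits : seq trit := [:: T0; T1; Tm].
Definition elts : seq F9 := [seq (a, b) | a <- trits, b <- trits].
Definition params : seq pline := None :: map some elts.

(** The entry that would be a deleted vertex gives way to the other end of the added edge. The
    argument of [ratio] is c, that is k for c (t - x)^2, and n for the constant c, whose double zero
    is at infinity. *)
Definition nbrs (v : vert) : seq vert :=
  match v with
  | circle k m n =>
      [seq let y := eval x k m n in let d := slope x k m n in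
           if is_zero y && is_zero d then
             let r := ratio (if is_zero k then n else k) in
             circle (mul r k) (mul r m) (mul r n)
           else flag x y d | x <- params]
  | point x y => point x (opp y) :: [seq flag x y d | d <- elts]
  | flag x y d =>
      (if is_zero y then flag x y (if x is Some _ then mate d else opp d)
       else point x y) :: [seq touching x y d c | c <- elts]
  end.

Definition kept (v : vert) : bool :=
  match v with
  | circle k m n => ~~ [&& is_zero k, is_zero m & is_zero n]
  | point x y => ~~ is_zero y
  | flag x y d => ~~ (is_zero y && is_zero d)
  end.

Definition verts : seq vert :=
  [seq circle p.1 p.2 n | p <- [seq (k, m) | k <- elts, m <- elts], n <- elts]
  ++ [seq point x y | x <- params, y <- elts]
  ++ [seq flag p.1 p.2 d | p <- [seq (x, y) | x <- params, y <- elts],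
                           d <- elts].

(** These codes are prefix-free, so they concatenate injectively; as keys of a [PositiveMap] they
    make distinctness fast to evaluate. *)
Definition code_trit (t : trit) (p : positive) : positive :=
  match t with
  | None => p~0 | Some true => p~0~1 | Some false => p~1~1
  end%positive.
Definition code_elt (x : F9) p := code_trit x.1 (code_trit x.2 p).
Definition code_param (x : pline) (p : positive) : positive :=
  if x is Some t then (code_elt t p)~1%positive else p~0%positive.
Definition code (v : vert) : positive :=
  match v with
  | circle k m n => (code_elt k (code_elt m (code_elt n 1)))~0
  | point x y => (code_param x (code_elt y 1))~0~1
  | flag x y d => (code_param x (code_elt y (code_elt d 1)))~1~1
  end%positive.

Fixpoint uniq_from (seen : PositiveMap.t unit) (s : seq positive) : bool :=
  if s is p :: s' then
    if PositiveMap.mem p seen then false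
    else uniq_from (PositiveMap.add p tt seen) s'
  else true.
Definition uniq_pos := uniq_from (PositiveMap.empty unit).

(* Walks are stored in reverse order. *)
Definition extend (p : seq vert) : seq (seq vert) :=
  if p is b :: a :: _ then
    let ca := code a in
    [seq x :: p | x <- nbrs b & ~~ Pos.eqb (code x) ca]
  else [::].
(** Closed walks of length 3, which are no arms, would be listed too; this only strengthens the test
    of distinct ends. *)
Definition arms (v : vert) : seq (seq vert) :=
  let l1 := [seq [:: a; v] | a <- nbrs v] in
  let l2 := flatten (map extend l1) in
  let l3 := flatten (map extend l2) in
  l1 ++ l2 ++ l3.
Definition arms_ok (v : vert) : bool :=
  uniq_pos [seq code (head v p) | p <- arms v].

Definition nbrs_ok (v : vert) : bool :=
  let cv := code v in
  uniq_pos (map code (nbrs v)) &&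
  all (fun u => [&& kept u, ~~ Pos.eqb (code u) cv &
                 has (fun w => Pos.eqb (code w) cv) (nbrs u)]) (nbrs v).

(** * Soundness of the evaluated tests *)

Lemma elts_full x : x \in elts.
Proof. by case: x => [[[]|] [[]|]]. Qed.

Lemma params_full x : x \in params.
Proof. by case: x => [[[[]|] [[]|]]|]. Qed.

Lemma verts_full v : v \in verts.
Proof.
have mem_cat3 (s t u : seq vert) w :
    (w \in s ++ t ++ u) = [|| w \in s, w \in t | w \in u] by rewrite !mem_cat.
rewrite mem_cat3; case: v => [[[k m] n]|[[x y]|[[x y] d]]].
- apply/orP; left; apply/allpairsP; exists ((k, m), n).
  by split; [apply: allpairs_f; apply: elts_full | apply: elts_full |].
- apply/orP; right; apply/orP; left; apply/allpairsP; exists (x, y).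
  by split; [apply: params_full | apply: elts_full |].
- apply/orP; right; apply/orP; right; apply/allpairsP; exists ((x, y), d).
  by split; [apply: allpairs_f; [apply: params_full | apply: elts_full]
            | apply: elts_full |].
Qed.

Lemma code_trit_inj s t p q : code_trit s p = code_trit t q -> s = t /\ p = q.
Proof. by case: s => [[]|]; case: t => [[]|] //= [->]. Qed.

Lemma code_elt_inj x y p q : code_elt x p = code_elt y q -> x = y /\ p = q.
Proof.
by case: x y => [a b] [c d] /code_trit_inj /= [-> /code_trit_inj[-> ->]].
Qed.

Lemma code_param_inj x y p q :
  code_param x p = code_param y q -> x = y /\ p = q.
Proof. by case: x y => [x|] [y|] //= => [[/code_elt_inj[-> ->]]|[->]]. Qed.

Lemma code_inj : injective code.
Proof.
move=> [[[k m] n]|[[x y]|[[x y] d]]] [[[k' m'] n']|[[x' y']|[[x' y'] d']]] //=.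
- by case=> /code_elt_inj[-> /code_elt_inj[-> /code_elt_inj[->]]].
- by case=> /code_param_inj[-> /code_elt_inj[->]].
- by case=> /code_param_inj[-> /code_elt_inj[-> /code_elt_inj[->]]].
Qed.

Lemma code_eqE u v : Pos.eqb (code u) (code v) = (u == v).
Proof. by apply/idP/eqP => [/Pos.eqb_eq/code_inj|->] //; apply/Pos.eqb_eq. Qed.

Lemma uniq_from_map (T : eqType) (f : T -> positive) seen s :
  uniq_from seen (map f s) ->
  [/\ {in s, forall x, ~~ PositiveMap.mem (f x) seen}, uniq s
    & {in s &, injective f}].
Proof.
elim: s seen => [|x s IHs] seen //=; case: ifP => // /negbT x_new.
move=> /IHs[s_new us f_inj].
have f_ne y : y \in s -> f x <> f y.
  by move=> /s_new + eq_f; rewrite -eq_f PositiveMap.mem_find PositiveMap.gss.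
split.
- move=> y; rewrite inE => /predU1P[-> //|ys].
  have := s_new y ys; rewrite !PositiveMap.mem_find PositiveMap.gso //.
  by move=> eq_f; case: (f_ne y ys).
- by rewrite us andbT; apply/negP=> /f_ne.
- move=> y z; rewrite !inE => /predU1P[->|ys] /predU1P[->|zs] //.
  + by move/f_ne: zs.
  + by move/esym; move/f_ne: ys.
  + exact: f_inj.
Qed.

Lemma nbrs_ok_kept v : kept v -> nbrs_ok v.
Proof.
have /allP ok : all nbrs_ok (filter kept verts) by vm_compute.
by move=> kv; apply: ok; rewrite mem_filter kv verts_full.
Qed.

Lemma arms_ok_kept v : kept v -> arms_ok v.
Proof.
have /allP ok : all arms_ok (filter kept verts) by vm_compute.
by move=> kv; apply: ok; rewrite mem_filter kv verts_full.
Qed.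

Lemma kept_nbrs u v :
  kept v -> u \in nbrs v -> [/\ kept u, u != v & v \in nbrs u].
Proof.
move=> /nbrs_ok_kept/andP[_ /allP ok] /ok /and3P[ku].
rewrite code_eqE => ne_uv /hasP[w wu].
by rewrite code_eqE => /eqP eq_wv; split=> //; rewrite -eq_wv.
Qed.

Lemma uniq_nbrs v : kept v -> uniq (nbrs v).
Proof. by move=> /nbrs_ok_kept/andP[/uniq_from_map[]]. Qed.

Lemma size_nbrs v : size (nbrs v) = 10.
Proof. by case: v => [[[k m] n]|[[x y]|[[x y] d]]]; rewrite /= ?size_map. Qed.

(** * The graph, its degree, girth and order *)

Notation kvert := {v : vert | kept v}.

Definition kadj : rel kvert := fun u v => val v \in nbrs (val u).

Lemma kadj_sym : symmetric kadj.
Proof. by move=> u v; apply/idP/idP => /kept_nbrs[] //; apply: valP. Qed.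

Lemma kadj_irrefl : irreflexive kadj.
Proof.
by move=> u; apply/negP => /kept_nbrs[|_ /eqP //]; apply: valP.
Qed.

Definition kgraph : sgraph := SGraph kadj_sym kadj_irrefl.

Lemma kgraph_regular : regular kgraph 10.
Proof.
move=> u; rewrite cardsE -(size_nbrs (val u)).
rewrite -(card_uniqP (uniq_nbrs (valP u))).
rewrite -(card_image val_inj); apply: eq_card => v.
apply/imageP/idP => [[w + ->] //|vu].
by have [kv _ _] := kept_nbrs (valP u) vu; exists (Sub v kv).
Qed.

Lemma mem_extend (a b x : vert) p :
  x \in nbrs b -> x != a -> x :: b :: a :: p \in extend (b :: a :: p).
Proof.
move=> xb ne_xa; apply/mapP; exists x => //.
by rewrite mem_filter xb code_eqE ne_xa.
Qed.

Lemma mem_arms (v : kgraph) (p : seq kgraph) :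
  arm 3 v p -> rev (map val (v :: p)) \in arms (val v).
Proof.
have ne_val (x y : kgraph) : x != y -> val x != val y.
  by rewrite (inj_eq val_inj).
rewrite /arms; set l1 := [seq [:: a; val v] | a <- nbrs (val v)].
set l2 := flatten (map _ l1); set l3 := flatten (map _ l2).
have in1 a : a \in nbrs (val v) -> [:: a; val v] \in l1.
  by move=> av; apply/mapP; exists a.
have in2 a b : a \in nbrs (val v) -> b \in nbrs a -> b != val v ->
    [:: b; a; val v] \in l2.
  move=> av ba ne; apply/flatten_mapP; exists [:: a; val v]; first exact: in1.
  exact: mem_extend.
case/and3P; case: p => [|a [|b [|c [|? ?]]]] //.
- move=> /= /andP[av _] _ _.
  by rewrite mem_cat in1.
- move=> /and3P[av ba _] /andP[+ _] _; rewrite !inE negb_or => /andP[_ vb].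
  by rewrite !mem_cat [X in _ || (X || _)]in2 ?orbT // ne_val // eq_sym.
- move=> /and4P[av ba cb _] /and3P[+ + _] _.
  rewrite !inE !negb_or => /and3P[_ vb _] /andP[_ ac].
  rewrite !mem_cat; apply/orP; right; apply/orP; right; apply/flatten_mapP.
  exists [:: val b; val a; val v]; first by rewrite in2 // ne_val // eq_sym.
  by apply: mem_extend => //; rewrite ne_val // eq_sym.
Qed.

Lemma kgraph_arm_inj (v : kgraph) (p q : seq kgraph) :
  arm 3 v p -> arm 3 v q -> last v p = last v q -> p = q.
Proof.
move=> /mem_arms vp /mem_arms vq eq_last.
have [_ _ inj] := uniq_from_map (arms_ok_kept (valP v)).
have head_arm s : head (val v) (rev (map val (v :: s))) = val (last v s).
  by rewrite lastI map_rcons rev_rcons.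
have := inj _ _ vp vq; rewrite !head_arm eq_last => /(_ erefl).
by move/(can_inj revK)/(inj_map val_inj) => [].
Qed.

Lemma kgraph_cycle7 : exists2 c : seq kgraph, graph_cycle c & size c = 7.
Proof.
(* One added edge joins the points (0, 1) and (0, -1); the circles 1 and t^2 + t - 1 through them
   touch at t = 1. *)
pose x0 : pline := Some zero; pose x1 : pline := Some (T1, T0).
pose e1 : F9 := (T1, T0); pose e2 : F9 := (Tm, T0).
exists [:: exist kept (circle zero zero e1) erefl;
  exist kept (flag x0 e1 zero) erefl; exist kept (point x0 e1) erefl;
  exist kept (point x0 e2) erefl; exist kept (flag x0 e2 e1) erefl;
  exist kept (circle e1 e1 e2) erefl; exist kept (flag x1 e1 zero) erefl] => //.
Qed.

Lemma card_kgraph : #|kgraph| <= 1608.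
Proof.
pose deleted : seq vert := circle zero zero zero ::
  [seq point x zero | x <- params] ++ [seq flag x zero zero | x <- params].
(* [vert] has 729 + 90 + 810 = 1629 elements, as it omits [oo] and the ten classes; 21 of the 32
   deleted vertices remain to be removed. *)
have : #|[predC kept]| >= 21.
  have /card_uniqP card_del : uniq deleted by vm_compute.
  apply: leq_trans (_ : #|deleted| <= _); first by rewrite card_del.
  by apply/subset_leq_card/subsetP/allP; vm_compute.
rewrite card_sig => del21; rewrite -(leq_add2r 21).
apply: leq_trans (leq_add (leqnn _) del21) _.
by rewrite cardC !(card_sum, card_prod, card_option, card_bool).
Qed.

Theorem mainTheorem9 : exists2 N : nat, is_n 10 7 N & N <= 1608.
Proof.
have kg : kg_graph 10 7 kgraph.
  split; first exact: kgraph_regular.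
  split; first exact: kgraph_cycle7.
  exact: (girth_gt_of_arms kgraph_arm_inj).
have [n nP [le_n min_n]] := @ex_min_nat (fun n =>
  exists2 G : sgraph, kg_graph 10 7 G & #|G| = n) #|kgraph|
  (ex_intro2 _ _ kgraph kg erefl).
exists n; last exact: leq_trans le_n card_kgraph.
by split=> // G kgG; apply: min_n; exists G.
Qed.
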